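(* Consider the two-states model described in the context, with $n$ users, and let $f_P$ be a continuous density for which there are $\delta_1,\delta_2>0$ with $\delta_1<f_P(p)<\delta_2$ for $p\in(0,1)$ and $f_P(p)=0$ for $p\notin(0,1)$. Suppose that $m=cn^{2+\alpha}$ for some $c>0$ and $\alpha>0$, and that $R_u\sim\mathrm{Uniform}[0,a_n]$ with $a_n=c'n^{-(1+\beta)}$ for some $c'>0$ and $\beta>\frac{\alpha}{4}$. Then user $1$ has no privacy as $n\to\infty$; that is, for every $k\in\mathbb{N}$, $$\inf_{\widetilde{X_1(k)}} P\left(\widetilde{X_1(k)}\ne X_1(k)\right)\longrightarrow 0\quad\text{as } n\to\infty,$$ where the infimum is over all estimators $\widetilde{X_1(k)}$ available to the adversary.
   Context: Two-states model. For each $n$ there are $n$ users. (Data) Parameters $P_1,\dots,P_n$ are drawn independently from the density $f_P$. Given $P_1=p_1,\dots,P_n=p_n$, the data $X_u(k)$, $k=1,2,\dots$, of user $u$ are i.i.d. $\mathrm{Bernoulli}(p_u)$, independent across users. (Obfuscation) Independently of everything else, $R_1,\dots,R_n$ are i.i.d. $\mathrm{Uniform}[0,a_n]$, where $a_n\in(0,1]$ (consider $n$ large enough that $a_n\le 1$). Each $R_u$ is drawn once and kept fixed for all times. Given the $X$'s and $R$'s, independently over $u$ and $k$, $Z_u(k)=X_u(k)$ with probability $1-R_u$ and $Z_u(k)=1-X_u(k)$ with probability $R_u$. Let $\mathbf{Z}_u=(Z_u(1),\dots,Z_u(m))^T$, where $m=m(n)$ is the number of observations per user (rounded to an integer). (Anonymization)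 $\Pi$ is a uniformly random permutation of $\{1,\dots,n\}$, independent of everything else, and $\mathbf{Y}=[\mathbf{Z}_{\Pi^{-1}(1)},\dots,\mathbf{Z}_{\Pi^{-1}(n)}]$ is the $m\times n$ matrix observed by the adversary. (Adversary) The adversary knows $P_1,\dots,P_n$ and $a_n$, but not $\Pi$ nor $R_1,\dots,R_n$; an estimator $\widetilde{X_1(k)}$ is a (measurable) function of $\mathbf{Y}$ and $(P_1,\dots,P_n)$ with values in $\{0,1\}$, possibly depending on $n$, $k$, $a_n$. *)

(* Defs.v *)
From HB Require Import structures.
From mathcomp Require Import all_boot all_order all_algebra all_fingroup.
From mathcomp Require Import all_classical all_reals all_analysis.

Set Implicit Arguments.
Unset Strict Implicit.
Unset Printing Implicit Defensive.

Import Order.TTheory GRing.Theory Num.Theory.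
Import numFieldNormedType.Exports.

Local Open Scope classical_set_scope.
Local Open Scope ring_scope.

(* Users are numbered from 0, so that user 1 is [ord0]. Times are numbered
   from 0 as well: [data u k] and [obfuscated u k] are the samples of user [u]
   at time [k + 1]. *)
Record users (R : realType) (d : measure_display) (Omega : measurableType d)
    (Pr : probability Omega R) (n : nat) := Users {
  param : 'I_n -> {RV Pr >-> R};
  data : 'I_n -> nat -> {RV Pr >-> bool};
  noise : 'I_n -> {RV Pr >-> R};
  obfuscated : 'I_n -> nat -> {RV Pr >-> bool};
  shuffle : Omega -> 'S_n
}.

Definition preimages (d d' : measure_display) (Omega : measurableType d)
    (T : measurableType d') (I : Type) (Y : I -> Omega -> T)
    : set (set Omega) :=
  \bigcup_(i in [set: I]) preimage_set_system [set: Omega] (Y i) measurable.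

Section TwoStates.
Context (R : realType) (d : measure_display) (Omega : measurableType d)
        (Pr : probability Omega R) (n : nat) (S : users Pr n).

Definition gen_param : set (set Omega) := preimages (param S).
Definition gen_data : set (set Omega) :=
  \bigcup_(u in [set: 'I_n]) preimages (data S u).
Definition gen_noise : set (set Omega) := preimages (noise S).
Definition gen_obfuscated : set (set Omega) :=
  \bigcup_(u in [set: 'I_n]) preimages (obfuscated S u).

(* Conditional laws are stated by integrating over all events of the
   conditioning sigma-algebra. [bernoulli_pmf p b] is [p] if [b] is true and
   [1 - p] otherwise; in the law of the obfuscated samples, its boolean argument
   [data S u k w (+) z u k] is true exactly when the sample has been flipped. *)
Record two_states_model (f : R -> R) (a : R) : Prop := TwoStatesModel {
  param_law : forall A : 'I_n -> set R, (forall u, measurable (A u)) ->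
    Pr [set w | forall u, A u (param S u w)] =
    (\prod_(u < n) \int[lebesgue_measure]_(p in A u) (f p)%:E)%E ;
  data_law : forall (E : set Omega) (K : nat) (x : 'I_n -> 'I_K -> bool),
    <<s gen_param >> E ->
    Pr (E `&` [set w | forall u (k : 'I_K), data S u k w = x u k]) =
    (\int[Pr]_(w in E)
       (\prod_(u < n) \prod_(k < K) bernoulli_pmf (param S u w) (x u k))%:E)%E ;
  noise_law : forall (E : set Omega) (B : 'I_n -> set R),
    <<s gen_param `|` gen_data >> E -> (forall u, measurable (B u)) ->
    Pr (E `&` [set w | forall u, B u (noise S u w)]) =
    (Pr E * \prod_(u < n)
       \int[lebesgue_measure]_(r in B u) (uniform_pdf 0 a r)%:E)%E ;
  obfuscated_law : forall (E : set Omega) (K : nat) (z : 'I_n -> 'I_K -> bool),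
    <<s gen_param `|` gen_data `|` gen_noise >> E ->
    Pr (E `&` [set w | forall u (k : 'I_K), obfuscated S u k w = z u k]) =
    (\int[Pr]_(w in E)
       (\prod_(u < n) \prod_(k < K)
          bernoulli_pmf (noise S u w) (data S u k w (+) z u k))%:E)%E ;
  shuffle_measurable : forall s : 'S_n,
    measurable (shuffle S @^-1` [set s]) ;
  shuffle_law : forall (E : set Omega) (s : 'S_n),
    <<s gen_param `|` gen_data `|` gen_noise `|` gen_obfuscated >> E ->
    Pr (E `&` shuffle S @^-1` [set s]) = (Pr E * (n`!%:R^-1)%:E)%E
}.

Definition params (w : Omega) : n.-tuple R := [tuple param S u w | u < n].

(* The [m] x [n] matrix seen by the adversary, as the tuple of its columns. *)
Definition observation (m : nat) (w : Omega) : n.-tuple (m.-tuple bool) :=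
  [tuple [tuple obfuscated S ((shuffle S w)^-1%g j) k w | k < m] | j < n].

Definition error_prob (m : nat)
    (g : n.-tuple (m.-tuple bool) * n.-tuple R -> bool) (u : 'I_n) (k : nat)
    : \bar R :=
  Pr [set w | g (observation m w, params w) != data S u k w].

Definition min_error_prob (m : nat) (u : 'I_n) (k : nat) : \bar R :=
  ereal_inf [set error_prob g u k |
    g in [set g : n.-tuple (m.-tuple bool) * n.-tuple R -> bool |
          measurable_fun [set: n.-tuple (m.-tuple bool) * n.-tuple R] g]].

End TwoStates.

(* Main.v *)
Require Import Defs.
From HB Require Import structures.
From mathcomp Require Import all_boot all_order all_algebra all_fingroup.
From mathcomp Require Import all_classical all_reals all_analysis.
From mathcomp Require Import measurable_realfun ring lra.

(* The adversary outputs the bit at time [k] of the observed columns whose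
   empirical mean lies within [t = n^-(1+gamma)] of the known [P_1]. Only user 1
   is matched this way, with high probability. Its own mean is close to [P_1]:
   the mean of the data by Chebyshev, since [m t^2] tends to infinity, and the
   effect of the obfuscation by Markov, since [a_n / t] tends to 0. For another
   user [u], no concentration is needed: [P_1] is independent of [Z_u] and has
   a density bounded by [delta2], so that [Z_u] is matched with probability at
   most [2 t delta2], and [n t] tends to 0. Existence of a matching column whose
   bit is 1 does not depend on the order of the columns, which disposes of the
   permutation. *)

Set Implicit Arguments.
Unset Strict Implicit.
Unset Printing Implicit Defensive.

Import Order.TTheory GRing.Theory Num.Theory.
Import numFieldNormedType.Exports.

Local Open Scope classical_set_scope.
Local Open Scope ring_scope.

(** * Sums over Boolean vectors and a Chebyshev bound for Bernoulli weights *)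

Lemma sum_prod_ffun (R : comNzRingType) (I : finType) (q : I -> bool -> R) :
  \sum_(y : {ffun I -> bool}) \prod_i q i (y i) =
  \prod_i (q i true + q i false).
Proof.
by rewrite -bigA_distr_bigA; apply: eq_bigr => i _; rewrite big_bool.
Qed.

(** Finite form of marginalization: each coordinate outside [J] is summed freely and contributes the
    factor 1. *)
Lemma sum_prod_fixed (R : comNzRingType) (I : finType) (q : I -> bool -> R)
    (J : {pred I}) (x : I -> bool) :
  (forall i, q i true + q i false = 1) ->
  \sum_(y : {ffun I -> bool} | [forall i in J, y i == x i]) \prod_i q i (y i) =
  \prod_(i in J) q i (x i).
Proof.
move=> q1; rewrite big_mkcond /=.
(* The constraint on [y] moves into the weights, which vanish on forbidden values; the sum then runs
   over all [y] and factorizes. *)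
pose r i b := if (i \in J) && (b != x i) then 0 else q i b.
transitivity (\sum_(y : {ffun I -> bool}) \prod_i r i (y i)).
  apply: eq_bigr => y _; case: ifPn => [/forall_inP yx|].
    apply: eq_bigr => i _; rewrite /r.
    by case: ifPn => // /andP[/yx /eqP ->]; rewrite eqxx.
  case/forall_inPn => i iJ yx.
  by rewrite (bigD1 i)//= /r iJ yx mul0r.
rewrite sum_prod_ffun [RHS]big_mkcond /=; apply: eq_bigr => i _.
rewrite /r; case: (i \in J) => //=.
by case: (x i); rewrite ?addr0 ?add0r.
Qed.

(** Once the square is expanded, the cross terms vanish because the summands are centred and
    independent, and each of the [K] diagonal terms is a variance, bounded crudely by 1. *)
Lemma bernoulli_second_moment (R : realFieldType) (K : nat) (p : R) :
  0 <= p <= 1 ->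
  \sum_(y : {ffun 'I_K -> bool})
     (\sum_k ((y k)%:R - p)) ^+ 2 * \prod_k (if y k then p else 1 - p)
  <= K%:R.
Proof.
move=> /andP[p0 p1].
pose b (c : bool) := if c then p else 1 - p.
(* The term of indices [k], [l] is a product over coordinates: the Bernoulli weight, times one
   centred factor for each of [k] and [l] that equals [i], hence a square when both do. *)
pose g (k l i : 'I_K) (c : bool) := b c *
  ((if i == k then c%:R - p else 1) * (if i == l then c%:R - p else 1)).
have -> : \sum_(y : {ffun 'I_K -> bool})
     (\sum_k ((y k)%:R - p)) ^+ 2 * \prod_k (if y k then p else 1 - p) =
   \sum_k \sum_l \sum_(y : {ffun 'I_K -> bool}) \prod_i g k l i (y i).
  under [RHS]eq_bigr => k _ do rewrite exchange_big /=.
  rewrite [RHS]exchange_big /=; apply: eq_bigr => y _.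
  rewrite expr2 mulr_suml mulr_suml; apply: eq_bigr => k _.
  rewrite mulr_sumr mulr_suml; apply: eq_bigr => l _.
  rewrite /g big_split big_split /= mulrC; congr (_ * _).
  by rewrite -!big_mkcond /= !big_pred1_eq.
have E k l : \sum_(y : {ffun 'I_K -> bool}) \prod_i g k l i (y i)
    <= (if l == k then 1 else 0).
  rewrite sum_prod_ffun (bigD1 k)//= /g /b eqxx.
  case: (eqVneq l k) => [->|lk].
    rewrite -[leRHS]mulr1; apply: ler_pM.
    - rewrite -!expr2 addr_ge0//.
        by rewrite mulr_ge0 ?sqr_ge0.
      by rewrite mulr_ge0 ?sqr_ge0 ?subr_ge0.
    - apply: prodr_ge0 => i ik; rewrite (negbTE ik) !mulr1.
      by rewrite addrC subrK.
    - by rewrite /=; nra.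
    - rewrite big1// => i ik; rewrite (negbTE ik) !mulr1.
      by rewrite addrC subrK.
  rewrite !mulr1 -[true%:R]/(1 : R) -[false%:R]/(0 : R).
  by rewrite [X in X * _](_ : _ = 0) ?mul0r//; ring.
apply: (le_trans (ler_sum _ (fun k _ => ler_sum _ (fun l _ => E k l)))).
under eq_bigr => k _ do rewrite -big_mkcond /= big_pred1_eq.
by rewrite sumr_const card_ord.
Qed.

(** On the deviation event, the centred sum has square at least [K ^ 2 * t ^ 2], while its second
    moment is at most [K]. *)
Lemma bernoulli_chebyshev (R : realFieldType) (K : nat) (p t : R) :
  (0 < K)%N -> 0 <= p <= 1 -> 0 < t ->
  \sum_(y : {ffun 'I_K -> bool} | t < `|(\sum_k (y k)%:R) / K%:R - p|)
     \prod_k (if y k then p else 1 - p)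
  <= (K%:R * t ^+ 2)^-1.
Proof.
move=> K0 p01 t0; have K0' : 0 < K%:R :> R by rewrite ltr0n.
rewrite -[leRHS]mul1r ler_pdivlMr; last by rewrite mulr_gt0 ?exprn_gt0.
rewrite -(ler_pM2l K0') mulr1; apply: le_trans (bernoulli_second_moment K p01).
rewrite mulr_suml mulr_sumr big_mkcond /=; apply: ler_sum => y _.
have P0 : 0 <= \prod_k (if y k then p else 1 - p).
  apply: prodr_ge0 => k _; case: ifP => _; case/andP: p01 => // *.
  by rewrite subr_ge0.
case: ifPn => [ht|_]; last by rewrite mulr_ge0 ?sqr_ge0.
rewrite mulrCA mulrC; apply: ler_wpM2r => //.
rewrite sumrB sumr_const card_ord -(mulr_natl p).
have -> : \sum_k (y k)%:R - K%:R * p =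
   K%:R * ((\sum_k (y k)%:R) / K%:R - p) :> R.
  by rewrite mulrBr mulrCA divff ?mulr1// gt_eqF.
rewrite mulrA -expr2 exprMn ler_pM2l ?exprn_gt0//.
rewrite -[leRHS]real_normK ?num_real//.
by rewrite ler_sqr ?nnegrE ?(ltW t0)// ltW.
Qed.

Lemma prod_user (R : comNzRingType) (n K : nat) (u : 'I_n)
    (F : 'I_n -> 'I_K -> R) :
  \prod_(i in [pred i : 'I_n * 'I_K | i.1 == u]) F i.1 i.2 = \prod_k F u k.
Proof.
have -> : \prod_k F u k = \prod_(v | v == u) \prod_k F v k.
  by rewrite big_pred1_eq.
by rewrite pair_big /=; apply: eq_bigl => i; rewrite andbT.
Qed.

(** * Empirical means, and measurability of finite conjunctions and disjunctions *)

Definition avg (R : realType) (K : nat) (b : 'I_K -> bool) : R :=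
  (\sum_k (b k)%:R) / K%:R.

Lemma measurable_avg (R : realType) (d : measure_display) (T : measurableType d)
    (K : nat) (W : 'I_K -> T -> bool) :
  (forall k, measurable_fun [set: T] (W k)) ->
  measurable_fun [set: T] (fun w => avg R (fun k => W k w)).
Proof.
move=> mW; rewrite /avg; apply: measurable_funM => //.
apply: measurable_sum => k.
exact: (measurableT_comp (f := fun b : bool => b%:R : R)).
Qed.

Lemma abs_avg_sub_le (R : realType) (K : nat) (x z : 'I_K -> bool) :
  `|avg R z - avg R x| <= avg R (fun k => z k != x k).
Proof.
rewrite /avg -mulrBl normrM [`|_^-1|]ger0_norm ?invr_ge0//.
apply: ler_wpM2r; first by rewrite invr_ge0.
rewrite -sumrB; apply: (le_trans (ler_norm_sum _ _ _)); apply: ler_sum => k _.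
by case: (z k); case: (x k);
  rewrite /= ?subrr ?subr0 ?sub0r ?normrN ?normr0 ?normr1.
Qed.

Lemma measurable_forall_fin (d : measure_display) (T : measurableType d)
    (I : finType) (W : I -> T -> bool) (x : I -> bool) :
  (forall i, measurable_fun [set: T] (W i)) ->
  measurable [set w | forall i, W i w = x i].
Proof.
move=> mW; rewrite [X in measurable X](_ : _ =
  \bigcap_(i in [set: I]) (W i @^-1` [set x i])); last first.
  by apply/seteqP; split => w H i *; exact: H.
apply: fin_bigcap_measurable => // i _.
by rewrite -[X in measurable X]setTI; exact: mW.
Qed.

Lemma measurable_exists_fin (d : measure_display) (T : measurableType d)
    (I : finType) (b : I -> T -> bool) :
  (forall i, measurable_fun [set: T] (b i)) ->
  measurable_fun [set: T] (fun w => [exists i, b i w]).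
Proof.
move=> mb; apply: (measurable_fun_bool true).
rewrite setTI (_ : _ @^-1` _ = \bigcup_(i in [set: I]) (b i @^-1` [set true])).
  apply: fin_bigcup_measurable => // i _.
  by rewrite -[X in measurable X]setTI; exact: mb.
apply/seteqP; split => w /=; first by move=> /existsP[i bi]; exists i.
by move=> [i _ bi]; apply/existsP; exists i.
Qed.

(** * Finite partitions, marginals and independence in a probability space *)

Section probability_facts.
Context (R : realType) (d : measure_display) (Omega : measurableType d)
        (Pr : probability Omega R).

Lemma probability_fin_partition (T : finType) (Y : Omega -> T)
    (E : set Omega) (P : pred T) :
  (forall t, measurable (E `&` Y @^-1` [set t])) ->
  Pr (E `&` [set w | P (Y w)]) =
  (\sum_(t | P t) Pr (E `&` Y @^-1` [set t]))%E.
Proof.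
move=> mY.
have -> : E `&` [set w | P (Y w)] =
    \bigcup_(t in [set` P]) (E `&` Y @^-1` [set t]).
  apply/seteqP; split => [w [Ew PYw]|w [t Pt [Ew /= Yt]]].
    by exists (Y w).
  by split => //=; rewrite Yt.
rewrite measure_fin_bigcup//.
- by apply/esym/bigfs => [|t _]; rewrite ?index_enum_uniq ?mem_index_enum.
- by move=> s t _ _ [w [[_ /= <-] [_ /= <-]]].
Qed.

Lemma measurable_bool_event (b : Omega -> bool) :
  measurable_fun [set: Omega] b -> measurable [set w | b w].
Proof. by move=> /(_ measurableT [set true]); rewrite setTI; apply. Qed.

(** The event on [J] is partitioned by the values of all coordinates. The sum goes under the
    integral, where [sum_prod_fixed] applies at each point of [E]. *)
Lemma product_law_marginal (I : finType) (W : I -> Omega -> bool)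
    (q : I -> bool -> Omega -> R) (E : set Omega) (J : {pred I})
    (x : I -> bool) :
  measurable E ->
  (forall i, measurable_fun [set: Omega] (W i)) ->
  (forall i b, measurable_fun [set: Omega] (q i b)) ->
  (forall i b w, 0 <= q i b w) ->
  (forall i w, q i true w + q i false w = 1) ->
  (forall y : I -> bool, Pr (E `&` [set w | forall i, W i w = y i]) =
     (\int[Pr]_(w in E) (\prod_i q i (y i) w)%:E)%E) ->
  Pr (E `&` [set w | forall i, i \in J -> W i w = x i]) =
  (\int[Pr]_(w in E) (\prod_(i in J) q i (x i) w)%:E)%E.
Proof.
move=> mE mW mq q0 q1 law.
pose Y w := [ffun i => W i w].
have YE (t : {ffun I -> bool}) :
    Y @^-1` [set t] = [set w | forall i, W i w = t i].
  apply/seteqP; split => [w /= <- i|w /= wt]; first by rewrite ffunE.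
  by apply/ffunP => i; rewrite ffunE.
have -> : [set w | forall i, i \in J -> W i w = x i] =
    [set w | [forall i in J, Y w i == x i]].
  apply/seteqP; split => w /=.
    by move=> H; apply/forall_inP => i /H; rewrite ffunE => /eqP.
  by move=> /forall_inP H i /H; rewrite ffunE => /eqP.
rewrite (probability_fin_partition
  (fun y : {ffun I -> bool} => [forall i in J, y i == x i])); last first.
  move=> t; apply: measurableI => //; rewrite YE.
  exact: measurable_forall_fin.
under eq_bigr => t _ do rewrite YE law.
(* Filtering the index list removes the predicate from the sum, which can then be exchanged with the
   integral. *)
rewrite -big_filter -ge0_integral_sum//; last 2 first.
- move=> t; apply/measurable_EFinP; apply: measurable_prod => i _.
  by apply: measurable_funTS.
- by move=> t w _; rewrite lee_fin; apply: prodr_ge0 => i _.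
apply: eq_integral => w _; rewrite big_filter sumEFin; congr EFin.
exact: (sum_prod_fixed (q := fun i b => q i b w)).
Qed.

(** The image under [V] of [Pr] restricted to [E] is, by independence, the law of [V] scaled by
    [Pr E]; both sides are integrals of [h] against this measure. *)
Lemma integral_indep (E : set Omega) (V : Omega -> R) (h : R -> \bar R) :
  measurable E -> measurable_fun [set: Omega] V ->
  (forall B, measurable B ->
     Pr (E `&` V @^-1` B) = (Pr E * Pr (V @^-1` B))%E) ->
  measurable_fun setT h -> (forall r, 0 <= h r)%E ->
  (\int[Pr]_(w in E) h (V w) = Pr E * \int[Pr]_w h (V w))%E.
Proof.
move=> mE mV ind mh h0.
have mhV : measurable_fun [set: Omega] (h \o V) by exact: measurableT_comp.
(* The restriction is a measure on the whole space that charges only [E], so that the integral over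
   [E] becomes one over the whole space, to which the change of variables by [V] applies. *)
pose nu : {measure set Omega -> \bar R} := mrestr Pr mE.
have c0 : 0 <= fine (Pr E) by rewrite fine_ge0.
pose c := NngNum c0.
have -> : (\int[Pr]_(w in E) h (V w) = \int[nu]_(w in E) h (V w))%E.
  apply: eq_measure_integral => A mA AE.
  by rewrite /nu /= /mrestr setIidl.
have -> : (\int[nu]_(w in E) h (V w) = \int[nu]_w h (V w))%E.
  rewrite [RHS](@ge0_negligible_integral _ _ _ nu _ (~` E))//.
  - by rewrite setDE setCK setTI.
  - exact: measurableC.
  - by rewrite /nu /= /mrestr setICl measure0.
rewrite -[LHS](@ge0_integral_pushforward _ _ _ _ _ _ mV nu setT h)//.
rewrite (@eq_measure_integral _ _ _ _ (mscale c (pushforward Pr V)));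
  last first.
  move=> A mA _; rewrite /= /mscale /pushforward /nu /= /mrestr.
  by rewrite setIC ind// fineK// fin_num_measure.
rewrite ge0_integral_mscale//= fineK ?fin_num_measure//; congr (_ * _)%E.
by rewrite ge0_integral_pushforward.
Qed.

Lemma probability_ffun_partition (K : nat) (W : 'I_K -> Omega -> bool)
    (E : set Omega) :
  measurable E -> (forall k, measurable_fun [set: Omega] (W k)) ->
  Pr E = (\sum_(t : {ffun 'I_K -> bool})
            Pr (E `&` [set w | forall k, W k w = t k]))%E.
Proof.
move=> mE mW; pose Y w := [ffun k => W k w].
have YE (t : {ffun 'I_K -> bool}) :
    Y @^-1` [set t] = [set w | forall k, W k w = t k].
  apply/seteqP; split => [w /= <- i|w /= wt]; first by rewrite ffunE.
  by apply/ffunP => i; rewrite ffunE.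
have {1}-> : E = E `&` [set w | predT (Y w)].
  by apply/seteqP; split => w // -[].
rewrite (probability_fin_partition predT) => [|t].
  by apply: eq_bigr => t _; rewrite YE.
apply: measurableI => //; rewrite YE.
exact: measurable_forall_fin.
Qed.

Lemma sub_generated_measurable (G : set (set Omega)) :
  G `<=` measurable -> <<s G >> `<=` measurable.
Proof. by apply: smallest_sub; exact: sigma_algebra_measurable. Qed.

Lemma preimages_measurable (d' : measure_display) (T : measurableType d')
    (I : Type) (Y : I -> {RV Pr >-> T}) :
  preimages (fun i => Y i : Omega -> T) `<=` measurable.
Proof. by move=> _ [i _ [B mB <-]]; exact: measurable_funP. Qed.

Lemma generatedI (G : set (set Omega)) (A B : set Omega) :
  <<s G >> A -> <<s G >> B -> <<s G >> (A `&` B).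
Proof. exact: (@measurableI _ (g_sigma_algebraType G)). Qed.

Lemma generated_setT (G : set (set Omega)) : <<s G >> [set: Omega].
Proof. exact: (@measurableT _ (g_sigma_algebraType G)). Qed.

End probability_facts.

(* [bernoulli_pmf r b] may be negative when [r] is outside [0, 1]; the
   parameters are in this interval only almost surely, and clamping them makes
   the weights nonnegative everywhere. *)
Definition clamp01 (R : realType) (r : R) : R := Num.max 0 (Num.min 1 r).

(** * Bernoulli weights with clamped parameters *)

Section clamped.
Context (R : realType).
Implicit Type r : R.

Lemma clamp01_itv r : 0 <= clamp01 r <= 1.
Proof. by rewrite /clamp01 le_max lexx /= ge_max ler01 ge_min lexx. Qed.

Lemma clamp01_id r : 0 <= r <= 1 -> clamp01 r = r.
Proof.
by move=> /andP[r0 r1]; rewrite /clamp01 (min_idPr r1) (max_idPr r0).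
Qed.

Lemma clamp01_le r s : 0 <= s -> r <= s -> clamp01 r <= s.
Proof. by move=> s0 rs; rewrite /clamp01 ge_max s0 ge_min rs orbT. Qed.

Lemma measurable_clamp01 : measurable_fun setT (@clamp01 R).
Proof. by apply: measurable_maxr => //; exact: measurable_minr. Qed.

Lemma bernoulli_clamp01_ge0 r b : 0 <= bernoulli_pmf (clamp01 r) b.
Proof. by rewrite bernoulli_pmf_ge0// clamp01_itv. Qed.

Lemma sum_bernoulli_addb r b :
  bernoulli_pmf r (b (+) true) + bernoulli_pmf r (b (+) false) = 1.
Proof. by case: b => /=; rewrite /bernoulli_pmf ?subrK// addrC subrK. Qed.

Lemma measurable_bernoulli_addb (d : measure_display) (T : measurableType d)
    (V : T -> R) (D : T -> bool) (b : bool) :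
  measurable_fun [set: T] V -> measurable_fun [set: T] D ->
  measurable_fun [set: T] (fun w => bernoulli_pmf (V w) (D w (+) b)).
Proof.
move=> mV mD; rewrite /bernoulli_pmf; apply: measurable_fun_ifT => //.
- case: b.
    rewrite (_ : (fun _ => _) = fun w => ~~ D w); first exact: measurable_neg.
    by apply/funext => w; rewrite addbT.
  by rewrite (_ : (fun _ => _) = D)//; apply/funext => w; rewrite addbF.
- exact: measurable_funB.
Qed.

(** This serves both levels of the model: [D] constantly false gives the law of the data with [V]
    the parameters, and [D] equal to the data gives the law of the obfuscated samples with [V] the
    noise. Clamping alters the integrand only on a null set. *)
Lemma clamped_marginal (d : measure_display) (Omega : measurableType d)
    (Pr : probability Omega R) (n K : nat) (V : 'I_n -> Omega -> R)
    (D W : 'I_n -> 'I_K -> Omega -> bool) (E : set Omega)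
    (J : {pred 'I_n * 'I_K}) (x : 'I_n * 'I_K -> bool) :
  measurable E ->
  (forall u, measurable_fun [set: Omega] (V u)) ->
  (forall u k, measurable_fun [set: Omega] (D u k)) ->
  (forall u k, measurable_fun [set: Omega] (W u k)) ->
  (forall u, {ae Pr, forall w, 0 <= V u w <= 1}) ->
  (forall y : 'I_n -> 'I_K -> bool,
     Pr (E `&` [set w | forall u k, W u k w = y u k]) =
     (\int[Pr]_(w in E) (\prod_(u < n) \prod_(k < K)
        bernoulli_pmf (V u w) (D u k w (+) y u k))%:E)%E) ->
  Pr (E `&` [set w | forall i, i \in J -> W i.1 i.2 w = x i]) =
  (\int[Pr]_(w in E)
     (\prod_(i in J) bernoulli_pmf (clamp01 (V i.1 w))
        (D i.1 i.2 w (+) x i))%:E)%E.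
Proof.
move=> mE mV mD mW V01 law.
have mcV u : measurable_fun [set: Omega] (fun w => clamp01 (V u w)).
  exact: (measurableT_comp measurable_clamp01).
apply: (product_law_marginal (W := fun i => W i.1 i.2)
  (q := fun i b w => bernoulli_pmf (clamp01 (V i.1 w)) (D i.1 i.2 w (+) b))).
- by [].
- by [].
- by move=> i b; exact: measurable_bernoulli_addb.
- by move=> i b w; exact: bernoulli_clamp01_ge0.
- by move=> i w; exact: sum_bernoulli_addb.
move=> y.
have -> : [set w | forall i, W i.1 i.2 w = y i] =
    [set w | forall u k, W u k w = y (u, k)].
  apply/seteqP; split => w /= H; first by move=> u k; exact: (H (u, k)).
  by move=> [u k]; exact: H.
rewrite law; apply: ae_eq_integral => //.
- apply/measurable_EFinP; apply: measurable_prod => u _.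
  apply: measurable_prod => k _; apply: measurable_funTS.
  exact: measurable_bernoulli_addb.
- apply/measurable_EFinP; apply: measurable_prod => i _.
  by apply: measurable_funTS; exact: measurable_bernoulli_addb.
(* As there are finitely many users, almost surely all the [V u] lie in [0, 1] at once, and there
   the two integrands agree. *)
- have aeF := ae_filter_ringOfSetsType Pr.
  apply: (@filterS _ _ aeF _ _ _ (@filter_forall _ _ _ _ aeF V01)).
  move=> w Vw _ /=; congr EFin.
  rewrite pair_bigA /=; apply: eq_bigr => -[u k] _ /=.
  by rewrite clamp01_id.
Qed.

End clamped.

(** * Marginal laws and independence in the two-states model *)

Section model.
Context (R : realType) (d : measure_display) (Omega : measurableType d)
        (Pr : probability Omega R) (n : nat) (S : users Pr n)
        (f : R -> R) (a : R) (model : two_states_model S f a).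

Lemma gen_param_measurable : gen_param S `<=` measurable.
Proof. exact: preimages_measurable. Qed.

Lemma gen_data_measurable : gen_data S `<=` measurable.
Proof. by move=> A [u _]; exact: preimages_measurable. Qed.

Lemma gen_noise_measurable : gen_noise S `<=` measurable.
Proof. exact: preimages_measurable. Qed.

Lemma param_event (A : set R) (u : 'I_n) (G : set (set Omega)) :
  measurable A -> gen_param S `<=` G ->
  <<s G >> (param S u @^-1` A).
Proof.
move=> mA PG; apply: sub_sigma_algebra; apply: PG.
by exists u => //; exists A => //; rewrite setTI.
Qed.

Lemma data_event (u : 'I_n) (K : nat) (x : 'I_K -> bool)
    (G : set (set Omega)) :
  gen_data S `<=` G ->
  <<s G >> [set w | forall k : 'I_K, data S u k w = x k].
Proof.
(* [Omega] is viewed with the generated sigma-algebra as its measurable structure, so that a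
   measurability lemma yields membership in [<<s G >>]. *)
move=> DG; pose T := g_sigma_algebraType G.
apply: (@measurable_forall_fin _ T _ (fun k : 'I_K => data S u k : T -> bool)).
move=> k _ B mB; rewrite setTI; apply: sub_sigma_algebra; apply: DG.
by exists u => //; exists k => //; exists B => //; rewrite setTI.
Qed.

(** [noise_law] at [E] and at the whole space gives the same product of integrals, once with the
    factor [Pr E] and once with the factor 1. *)
Lemma noise_indep (E : set Omega) (u : 'I_n) (B : set R) :
  <<s gen_param S `|` gen_data S >> E -> measurable B ->
  Pr (E `&` noise S u @^-1` B) = (Pr E * Pr (noise S u @^-1` B))%E.
Proof.
move=> GE mB; pose Bs (v : 'I_n) := if v == u then B else setT.
have mBs v : measurable (Bs v) by rewrite /Bs; case: ifP.
have BsE : [set w | forall v, Bs v (noise S v w)] = noise S u @^-1` B.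
  apply/seteqP; split => w /=; first by move/(_ u); rewrite /Bs eqxx.
  by move=> Bw v; rewrite /Bs; case: eqVneq => // ->.
have lawE := noise_law model GE mBs.
have GT := generated_setT (G := gen_param S `|` gen_data S).
have lawT := noise_law model GT mBs.
rewrite BsE in lawE lawT.
by rewrite lawE -[in RHS](setTI (_ @^-1` _)) lawT probability_setT mul1e.
Qed.

Lemma noise_range (u : 'I_n) : {ae Pr, forall w, 0 <= noise S u w <= a}.
Proof.
pose B : set R := ~` [set` `[0, a]].
have mB : measurable B by apply: measurableC.
exists (noise S u @^-1` B); split.
- by rewrite -[X in measurable X]setTI; exact: measurable_funP.
- pose Bs (v : 'I_n) := if v == u then B else setT.
  have mBs v : measurable (Bs v) by rewrite /Bs; case: ifP.
  have -> : noise S u @^-1` B =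
      setT `&` [set w | forall v, Bs v (noise S v w)].
    rewrite setTI; apply/seteqP; split => w /=.
      by move=> Bw v; rewrite /Bs; case: eqVneq => // ->.
    by move/(_ u); rewrite /Bs eqxx.
  have GT := generated_setT (G := gen_param S `|` gen_data S).
  rewrite (noise_law model GT mBs).
  rewrite (bigD1 u)//=.
  (* The factor of user [u] is zero, since the uniform density vanishes off [0, a]. *)
  rewrite /Bs eqxx integral0_eq ?mul0e ?mule0//.
  by move=> r; rewrite /B /= in_itv /= /uniform_pdf => /negP/negbTE ->.
- by move=> w /=; rewrite /B /= in_itv /=.
Qed.

Section param.
Context (f_int : (\int[lebesgue_measure]_p (f p)%:E = 1)%E).

Lemma param_marginal (u : 'I_n) (B : set R) : measurable B ->
  Pr (param S u @^-1` B) = (\int[lebesgue_measure]_(p in B) (f p)%:E)%E.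
Proof.
move=> mB; pose Bs (v : 'I_n) := if v == u then B else setT.
have mBs v : measurable (Bs v) by rewrite /Bs; case: ifP.
have -> : param S u @^-1` B = [set w | forall v, Bs v (param S v w)].
  apply/seteqP; split => w /=; last by move/(_ u); rewrite /Bs eqxx.
  by move=> Bw v; rewrite /Bs; case: eqVneq => // ->.
rewrite (param_law model mBs) (bigD1 u)//= big1 ?mule1 /Bs ?eqxx//.
by move=> v /negbTE ->.
Qed.

Lemma param_indep (u v : 'I_n) (A B : set R) : u != v ->
  measurable A -> measurable B ->
  Pr (param S u @^-1` A `&` param S v @^-1` B) =
  (Pr (param S u @^-1` A) * Pr (param S v @^-1` B))%E.
Proof.
move=> uv mA mB.
pose Bs (i : 'I_n) := if i == u then A else if i == v then B else setT.
have mBs i : measurable (Bs i) by rewrite /Bs; do 2 case: ifP => // _.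
have -> : param S u @^-1` A `&` param S v @^-1` B =
    [set w | forall i, Bs i (param S i w)].
  apply/seteqP; split => w /=.
    move=> [Aw Bw] i; rewrite /Bs; case: eqVneq => [->//|_].
    by case: eqVneq => // ->.
  move=> H; split; first by have := H u; rewrite /Bs eqxx.
  by have := H v; rewrite /Bs eq_sym (negbTE uv) eqxx.
rewrite !param_marginal// (param_law model mBs) (bigD1 u)//=.
rewrite (bigD1 v)/=; last first.
  by rewrite eq_sym.
rewrite big1 ?mule1 /Bs ?eqxx 1?eq_sym ?(negbTE uv)//.
by move=> i /andP[/negbTE -> /negbTE ->].
Qed.

Lemma param_range (u : 'I_n) :
  (forall p, ~~ (0 < p < 1) -> f p = 0) ->
  {ae Pr, forall w, 0 <= param S u w <= 1}.
Proof.
move=> f_out; pose B : set R := ~` [set` `[0, 1]].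
have mB : measurable B by apply: measurableC.
exists (param S u @^-1` B); split.
- by rewrite -[X in measurable X]setTI; exact: measurable_funP.
- rewrite param_marginal// integral0_eq// => p /=.
  rewrite /B /= in_itv /= => p01; rewrite f_out//.
  by apply/negP => /andP[p0 p1]; apply: p01; rewrite !ltW.
- by move=> w /=; rewrite /B /= in_itv /=.
Qed.

End param.

Lemma generated_measurable (E : set Omega) :
  <<s gen_param S `|` gen_data S `|` gen_noise S >> E -> measurable E.
Proof.
apply: sub_generated_measurable => A [[]|].
- exact: gen_param_measurable.
- exact: gen_data_measurable.
- exact: gen_noise_measurable.
Qed.

Lemma data_user_law (E : set Omega) (u : 'I_n) (K : nat) (x : 'I_K -> bool) :
  (forall v, {ae Pr, forall w, 0 <= param S v w <= 1}) ->
  <<s gen_param S >> E ->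
  Pr (E `&` [set w | forall k : 'I_K, data S u k w = x k]) =
  (\int[Pr]_(w in E)
     (\prod_(k < K) bernoulli_pmf (clamp01 (param S u w)) (x k))%:E)%E.
Proof.
move=> P01 GE.
have mE : measurable E.
  by apply: (sub_generated_measurable _ GE); exact: gen_param_measurable.
have := @clamped_marginal R _ _ Pr n K (fun v => param S v)
  (fun _ _ _ => false) (fun v k => data S v k) E
  [pred i | i.1 == u] (fun i => x i.2) mE.
rewrite (_ : [set w | forall i, _] =
  [set w | forall k : 'I_K, data S u k w = x k]); last first.
  apply/seteqP; split => w /= H; first by move=> k; exact: (H (u, k) (eqxx u)).
  by move=> [v k]; rewrite inE /= => /eqP ->.
move=> -> //.
- apply: eq_integral => w _; congr EFin.
  exact: (prod_user u
    (fun v k => bernoulli_pmf (clamp01 (param S v w)) (false (+) x k))).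
- by move=> y; rewrite (data_law model y GE).
Qed.

(** * Obfuscated samples: laws, independence and tail bounds *)

Section noisy.
Context (a0 : 0 <= a) (a1 : a <= 1).

Lemma noise01 (v : 'I_n) : {ae Pr, forall w, 0 <= noise S v w <= 1}.
Proof.
have aeF := ae_filter_ringOfSetsType Pr.
apply: (@filterS _ _ aeF _ _ _ (noise_range v)) => w /andP[-> /= h].
exact: le_trans h a1.
Qed.

Lemma obfuscated_marginal (E : set Omega) (K : nat)
    (J : {pred 'I_n * 'I_K}) (z : 'I_n * 'I_K -> bool) :
  <<s gen_param S `|` gen_data S `|` gen_noise S >> E ->
  Pr (E `&` [set w | forall i, i \in J -> obfuscated S i.1 i.2 w = z i]) =
  (\int[Pr]_(w in E) (\prod_(i in J)
     bernoulli_pmf (clamp01 (noise S i.1 w)) (data S i.1 i.2 w (+) z i))%:E)%E.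
Proof.
move=> GE; have mE := generated_measurable GE.
apply: (@clamped_marginal R _ _ Pr n K (fun v => noise S v)
  (fun v k => data S v k) (fun v k => obfuscated S v k)) => //.
- exact: noise01.
- by move=> y; rewrite (obfuscated_law model y GE).
Qed.

Lemma obfuscated_user_law (E : set Omega) (u : 'I_n) (K : nat)
    (z : 'I_K -> bool) :
  <<s gen_param S `|` gen_data S `|` gen_noise S >> E ->
  Pr (E `&` [set w | forall k : 'I_K, obfuscated S u k w = z k]) =
  (\int[Pr]_(w in E) (\prod_(k < K)
     bernoulli_pmf (clamp01 (noise S u w)) (data S u k w (+) z k))%:E)%E.
Proof.
move=> GE.
have := obfuscated_marginal [pred i | i.1 == u] (fun i => z i.2) GE.
rewrite (_ : [set w | forall i, _] =
  [set w | forall k : 'I_K, obfuscated S u k w = z k]); last first.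
  apply/seteqP; split => w /= H; first by move=> k; exact: (H (u, k) (eqxx u)).
  by move=> [v k]; rewrite inE /= => /eqP ->.
move=> ->; apply: eq_integral => w _; congr EFin.
exact: (prod_user u (fun v k =>
  bernoulli_pmf (clamp01 (noise S v w)) (data S v k w (+) z k))).
Qed.

(** Given either value of the data bit, the flip has conditional probability equal to the noise,
    which is at most [a] almost surely; the two cases add up to [a] times a probability. *)
Lemma flip_prob (u : 'I_n) (k : nat) :
  (Pr [set w | obfuscated S u k w != data S u k w] <= a%:E)%E.
Proof.
pose Eb b := [set w | data S u k w = b].
have GE b : <<s gen_param S `|` gen_data S `|` gen_noise S >> (Eb b).
  apply: sub_sigma_algebra; left; right; exists u => //; exists k => //.
  by exists [set b] => //; rewrite setTI.
have mE b : measurable (Eb b) := generated_measurable (GE b).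
have step b : (Pr (Eb b `&` [set w | obfuscated S u k w = ~~ b])
               <= a%:E * Pr (Eb b))%E.
  (* Time [k] is the last index of ['I_k.+1], the shortest horizon that contains it. *)
  have := obfuscated_marginal (pred1 (u, @ord_max k)) (fun=> ~~ b) (GE b).
  rewrite (_ : [set w | forall i, _] =
    [set w | obfuscated S u k w = ~~ b]); last first.
    apply/seteqP; split => w /= H; first exact: (H (u, ord_max) (eqxx _)).
    by move=> i /eqP ->.
  under eq_integral => w _ do rewrite (big_pred1 (u, ord_max))//=.
  move=> ->; rewrite -integral_cst//.
  apply: ae_ge0_le_integral => //.
  - by move=> w _; rewrite lee_fin bernoulli_clamp01_ge0.
  - apply/measurable_EFinP; apply: measurable_funTS.
    apply: measurable_bernoulli_addb => //.
    by apply: (measurableT_comp (@measurable_clamp01 R)).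
  - have aeF := ae_filter_ringOfSetsType Pr.
    apply: (@filterS _ _ aeF _ _ _ (noise_range u)) => w /andP[_ ra] /= Ew.
    rewrite lee_fin Ew (_ : b (+) ~~ b); last by case: (b).
    exact: clamp01_le.
have -> : [set w | obfuscated S u k w != data S u k w] =
    (Eb true `&` [set w | obfuscated S u k w = ~~ true]) `|`
    (Eb false `&` [set w | obfuscated S u k w = ~~ false]).
  apply/seteqP; split => w /=; rewrite /Eb /=.
    by case: (obfuscated S u k w); case: (data S u k w) => //=; [right|left].
  by case=> -[-> ->].
have mO b : measurable (Eb b `&` [set w | obfuscated S u k w = ~~ b]).
  apply: measurableI => //.
  exact: (@measurable_funPTI _ _ _ _ (obfuscated S u k) [set ~~ b]).
apply: le_trans; first exact: measureU2 (mO true) (mO false).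
apply: (le_trans (leeD (step true) (step false))).
rewrite -ge0_muleDr// -measureU//.
  have mEE := measurableU _ _ (mE true) (mE false).
  by rewrite -[leRHS]mule1; apply: lee_wpmul2l; [rewrite lee_fin|
    exact: probability_le1].
by apply/seteqP; split => w //= -[]; rewrite /Eb /= => ->.
Qed.

(** Once the data vector is fixed to [x], the deviation is the event [B x] on the parameter alone,
    so [data_user_law] gives its probability. Summed under the integral, these weights are bounded
    pointwise in the parameter by [bernoulli_chebyshev]. *)
Lemma data_chebyshev (u : 'I_n) (K : nat) (t : R) :
  (forall v, {ae Pr, forall w, 0 <= param S v w <= 1}) ->
  (0 < K)%N -> 0 < t ->
  (Pr [set w | t < `|avg R (fun k : 'I_K => data S u k w) - param S u w| ]%R
     <= ((K%:R * t ^+ 2)^-1)%:E)%E.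
Proof.
move=> P01 K0 t0; set A := [set w | _].
have mavg : measurable_fun [set: Omega]
    (fun w => avg R (fun k : 'I_K => data S u k w)).
  by apply: measurable_avg => k.
have mA : measurable A.
  apply: measurable_bool_event; apply: measurable_fun_ltr => //.
  apply: measurableT_comp => //; exact: measurable_funB.
rewrite (probability_ffun_partition Pr
    (W := fun k : 'I_K => data S u k))//.
pose B (x : {ffun 'I_K -> bool}) : set R := [set p | t < `|avg R x - p|].
have mB x : measurable (B x).
  rewrite /B (_ : [set p | _] =
    (fun p : R => t < `|avg R x - p|) @^-1` [set true])//.
  rewrite -[X in measurable X]setTI.
  have mf : measurable_fun [set: R] (fun p : R => t < `|avg R x - p|).
    apply: measurable_fun_ltr => //; apply: measurableT_comp => //.
    exact: measurable_funB.
  exact: mf.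
pose h (x : {ffun 'I_K -> bool}) w : R :=
  \prod_(k < K) bernoulli_pmf (clamp01 (param S u w)) (x k).
have mh x : measurable_fun [set: Omega] (fun w => (h x w)%:E).
  apply/measurable_EFinP; apply: measurable_prod => k _.
  apply: (@measurable_bernoulli_addb _ _ _ _ (fun=> false)) => //.
  exact: (measurableT_comp (@measurable_clamp01 R)).
have h0 x w : 0 <= h x w.
  by apply: prodr_ge0 => k _; exact: bernoulli_clamp01_ge0.
have mPB x : measurable (param S u @^-1` B x) by exact: measurable_funPTI.
have mhB x : measurable_fun [set: Omega]
    ((fun w => (h x w)%:E) \_ (param S u @^-1` B x)).
  by apply/(measurable_restrictT _ _).1 => //; exact: measurable_funTS.
(* The domain of integration depends on [x]; extending the integrands by 0 gives a common domain, on
   which sum and integral commute. *)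
have -> : (\sum_(x : {ffun 'I_K -> bool})
    Pr (A `&` [set w | forall k : 'I_K, data S u k w = x k]))%E =
    (\sum_(x : {ffun 'I_K -> bool})
       \int[Pr]_w (((fun w => (h x w)%:E) \_ (param S u @^-1` B x)) w))%E.
  apply: eq_bigr => x _; rewrite -integral_mkcond.
  rewrite -data_user_law//; last exact: param_event.
  congr (Pr _); apply/seteqP; split => w [/= Aw xw]; split => //=.
    by rewrite /B /= /avg; under eq_bigr do rewrite -xw.
  by move: Aw; rewrite /A /B /= /avg; under eq_bigr do rewrite -xw.
rewrite -ge0_integral_sum//; last first.
  by move=> x w _; rewrite patchE; case: ifP => // _; rewrite lee_fin.
rewrite -[leRHS]mule1 -(probability_setT Pr) -integral_cst//.
apply: ae_ge0_le_integral => //.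
- move=> w _; apply: sume_ge0 => x _.
  by rewrite patchE; case: ifP => // _; rewrite lee_fin.
- by exact: emeasurable_sum.
- by move=> w _; rewrite lee_fin invr_ge0 mulr_ge0 ?sqr_ge0.
have aeF := ae_filter_ringOfSetsType Pr.
apply: (@filterS _ _ aeF _ _ _ (P01 u)) => w Pw _ /=.
have := bernoulli_chebyshev K0 Pw t0.
rewrite -lee_fin; apply: le_trans.
rewrite -sumEFin [leRHS]big_mkcond; apply: lee_sum => x _; rewrite patchE.
rewrite (_ : (w \in _) = (t < `|(\sum_k (x k)%:R) / K%:R - param S u w|)).
  by case: ifP => // _; rewrite lee_fin /h clamp01_id.
by apply/idP/idP; rewrite inE.
Qed.

(** On an event of the parameters, the probability of [x] is the integral of a function of the
    parameter of [u] only, which is independent of that of [v]. *)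
Lemma param_data_indep (u v : 'I_n) (A : set R) (K : nat) (x : 'I_K -> bool) :
  (\int[lebesgue_measure]_p (f p)%:E = 1)%E ->
  (forall v, {ae Pr, forall w, 0 <= param S v w <= 1}) ->
  v != u -> measurable A ->
  Pr (param S v @^-1` A `&` [set w | forall k : 'I_K, data S u k w = x k]) =
  (Pr (param S v @^-1` A) * Pr [set w | forall k : 'I_K, data S u k w = x k])%E.
Proof.
move=> f_int P01 vu mA.
pose h (p : R) := (\prod_(k < K) bernoulli_pmf (clamp01 p) (x k))%:E.
have mE : measurable (param S v @^-1` A) by exact: measurable_funPTI.
rewrite data_user_law//; last exact: param_event.
rewrite -[X in (_ * Pr X)%E]setTI data_user_law//; last exact: generated_setT.
apply: (integral_indep (h := h)) => //.
- by move=> B mB; exact: param_indep.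
- apply/measurable_EFinP; apply: measurable_prod => k _.
  by apply: (@measurable_bernoulli_addb _ _ _ _ (fun=> false)) => //;
    exact: measurable_clamp01.
- by move=> p; rewrite lee_fin; apply: prodr_ge0 => k _;
    exact: bernoulli_clamp01_ge0.
Qed.

(** Partitioning by the data of [u] writes the probability as that of the parameter event times a
    factor free of this event; taking the whole line identifies the factor. *)
Lemma param_obfuscated_indep (u v : 'I_n) (A : set R) (K : nat)
    (z : 'I_K -> bool) :
  (\int[lebesgue_measure]_p (f p)%:E = 1)%E ->
  (forall v, {ae Pr, forall w, 0 <= param S v w <= 1}) ->
  v != u -> measurable A ->
  Pr (param S v @^-1` A `&`
      [set w | forall k : 'I_K, obfuscated S u k w = z k]) =
  (Pr (param S v @^-1` A) *
   Pr [set w | forall k : 'I_K, obfuscated S u k w = z k])%E.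
Proof.
move=> f_int P01 vu.
pose X (x : {ffun 'I_K -> bool}) :=
  [set w | forall k : 'I_K, data S u k w = x k].
pose Z := [set w | forall k : 'I_K, obfuscated S u k w = z k].
pose h (x : {ffun 'I_K -> bool}) (r : R) :=
  (\prod_(k < K) bernoulli_pmf (clamp01 r) (x k (+) z k))%:E.
have mZ : measurable Z by exact: measurable_forall_fin.
have decomp C : measurable C -> Pr (param S v @^-1` C `&` Z) =
    (Pr (param S v @^-1` C) *
     \sum_(x : {ffun 'I_K -> bool})
        (Pr (X x) * \int[Pr]_w h x (noise S u w)))%E.
  move=> mC.
  have mE : measurable (param S v @^-1` C) by exact: measurable_funPTI.
  rewrite (probability_ffun_partition Pr
    (W := fun k : 'I_K => data S u k))//; last first.
    exact: measurableI.
  rewrite ge0_sume_distrr; last first.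
    move=> x _; rewrite mule_ge0// integral_ge0// => w _.
    by rewrite lee_fin; apply: prodr_ge0 => k _; exact: bernoulli_clamp01_ge0.
  apply: eq_bigr => x _; rewrite -/(X x) muleA -param_data_indep//.
  have GE : <<s gen_param S `|` gen_data S >> (param S v @^-1` C `&` X x).
    apply: generatedI; first by apply: param_event => // B; left.
    by apply: data_event => B; right.
  have GE' : <<s gen_param S `|` gen_data S `|` gen_noise S >>
      (param S v @^-1` C `&` X x).
    (* The event is needed in two sigma-algebras: without the noise for [noise_indep], with it for
       [obfuscated_user_law]. *)
    move: GE; apply: smallest_sub; first exact: smallest_sigma_algebra.
    by move=> B GB; apply: sub_sigma_algebra; left.
  have mEx := generated_measurable GE'.
  rewrite setIAC obfuscated_user_law//.
  (* On [X x] the data equal [x], so the integrand depends on the noise alone. *)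
  rewrite (eq_integral (fun w => h x (noise S u w))); last first.
    move=> w; rewrite inE => -[_ xw]; rewrite /h.
    by under eq_bigr do rewrite xw.
  apply: integral_indep => //.
  - by move=> B mB; exact: noise_indep.
  - apply/measurable_EFinP; apply: measurable_prod => k _.
    by apply: (@measurable_bernoulli_addb _ _ _ _ (fun=> x k)) => //;
      exact: measurable_clamp01.
  - by move=> p; rewrite lee_fin; apply: prodr_ge0 => k _;
      exact: bernoulli_clamp01_ge0.
move=> mA; rewrite -/Z decomp//; congr (_ * _)%E.
have := decomp _ measurableT.
by rewrite preimage_setT setTI probability_setT mul1e.
Qed.

Lemma param_interval_prob (v : 'I_n) (delta2 c t : R) :
  (\int[lebesgue_measure]_p (f p)%:E = 1)%E ->
  measurable_fun setT f -> (forall p, 0 <= f p <= delta2) -> 0 < t ->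
  (Pr (param S v @^-1` [set` `[c - t, c + t]%R]) <= (2 * t * delta2)%:E)%E.
Proof.
move=> f_int mf f_le t0; rewrite param_marginal//.
apply: (@le_trans _ _
  (\int[lebesgue_measure]_(p in [set` `[(c - t)%R, (c + t)%R]])
     (cst delta2%:E) p)%E).
  apply: ge0_le_integral => //.
  - by move=> p _; rewrite lee_fin; case/andP: (f_le p).
  - by apply/measurable_EFinP; apply: measurable_funTS.
  - by move=> p _; rewrite lee_fin; case/andP: (f_le p).
rewrite integral_cst//= lebesgue_measure_itv /= lte_fin.
rewrite ifT; last by lra.
by rewrite -EFinB -EFinM lee_fin le_eqVlt; apply/orP; left; apply/eqP; ring.
Qed.

(** Here [v] is the attacked user and [u] another one. For each fixed value [z] of the samples of
    [u], closeness puts the parameter of [v] in an interval of length [2 * t]; by independence the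
    bound is uniform in [z] and survives averaging. *)
Lemma close_mean_prob (u v : 'I_n) (K : nat) (delta2 t : R) :
  (\int[lebesgue_measure]_p (f p)%:E = 1)%E ->
  measurable_fun setT f -> (forall p, 0 <= f p <= delta2) ->
  (forall v, {ae Pr, forall w, 0 <= param S v w <= 1}) ->
  v != u -> 0 < t ->
  (Pr [set w |
      `|avg R (fun k : 'I_K => obfuscated S u k w) - param S v w| <= t]%R
     <= (2 * t * delta2)%:E)%E.
Proof.
move=> f_int mf f_le P01 vu t0; set A := [set w | _].
have mavg : measurable_fun [set: Omega]
    (fun w => avg R (fun k : 'I_K => obfuscated S u k w)).
  by apply: measurable_avg => k.
have mA : measurable A.
  apply: measurable_bool_event; apply: measurable_fun_ler => //.
  apply: measurableT_comp => //; exact: measurable_funB.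
rewrite (probability_ffun_partition Pr
    (W := fun k : 'I_K => obfuscated S u k))//.
pose B (z : {ffun 'I_K -> bool}) : set R :=
  [set` `[(avg R z - t)%R, (avg R z + t)%R]].
pose Z (z : {ffun 'I_K -> bool}) :=
  [set w | forall k : 'I_K, obfuscated S u k w = z k].
have AE z : A `&` Z z = param S v @^-1` B z `&` Z z.
  have H w : Z z w -> A w <-> B z (param S v w).
    move=> zw; rewrite /A /B /= in_itv /= distrC ler_distl /avg.
    by under eq_bigr do rewrite zw.
  by apply/seteqP; split => w [/= Aw zw]; split => //; exact/(H w zw).
apply: (@le_trans _ _ (\sum_(z : {ffun 'I_K -> bool})
    (2 * t * delta2)%:E * Pr (Z z))%E).
  apply: lee_sum => z _; rewrite -/(Z z) AE.
  rewrite param_obfuscated_indep//; last exact: measurable_itv.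
  apply: lee_wpmul2r => //.
  exact: param_interval_prob.
rewrite -ge0_sume_distrr//.
have := probability_ffun_partition Pr measurableT
  (fun k : 'I_K => measurable_funP (obfuscated S u k)).
under eq_bigr do rewrite setTI.
by rewrite /Z => <-; rewrite probability_setT mule1.
Qed.

Lemma flip_rate_prob (u : 'I_n) (K : nat) (t : R) : (0 < K)%N -> 0 < t ->
  (Pr [set w | t <=
      avg R (fun k : 'I_K => obfuscated S u k w != data S u k w)]%R
     <= (a / t)%:E)%E.
Proof.
move=> K0 t0; have K0' : 0 < K%:R :> R by rewrite ltr0n.
pose F (k : 'I_K) w := obfuscated S u k w != data S u k w.
have mF k : measurable_fun [set: Omega] (F k).
  rewrite /F (_ : (fun w => _) = fun w => if data S u k w
    then ~~ obfuscated S u k w else obfuscated S u k w).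
    by apply: measurable_fun_ifT => //; exact: measurable_neg.
  by apply/funext => w; case: (obfuscated _ _ _ _); case: (data _ _ _ _).
pose g w : R := avg R (fun k => F k w).
have mg : measurable_fun [set: Omega] g by exact: measurable_avg.
have g0 w : 0 <= g w by rewrite /g /avg divr_ge0// sumr_ge0.
have mgE : measurable_fun [set: Omega] (EFin \o g) by exact/measurable_EFinP.
(* Markov's inequality; by linearity and [flip_prob], the expected proportion of flips is at most
   [a]. *)
have := @le_integral_abse _ _ _ Pr setT measurableT (EFin \o g) t mgE t0.
rewrite setTI (_ : [set w | (_ <= `|_|)%E] = [set w | t <= g w]); last first.
  by apply/seteqP; split => w /=; rewrite ger0_norm.
rewrite (eq_integral (fun w => \sum_(k < K) (K%:R^-1 * (F k w)%:R)%:E)%E);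
  last first.
  move=> w _; rewrite /= ger0_norm// /g /avg mulr_suml sumEFin; congr EFin.
  by apply: eq_bigr => k _; rewrite mulrC.
have mFE k : measurable_fun [set: Omega]
    (fun w => (K%:R^-1 * (F k w)%:R)%:E : \bar R).
  apply/measurable_EFinP; apply: measurable_funM => //.
  exact: (measurableT_comp (f := fun b : bool => b%:R : R)).
rewrite ge0_integral_sum//.
have Fk k : (\int[Pr]_w (K%:R^-1 * (F k w)%:R)%:E <= (K%:R^-1 * a)%:E)%E.
  have mFk : measurable [set w | F k w] by exact: measurable_bool_event.
  under eq_integral => w _ do rewrite EFinM.
  rewrite ge0_integralZl//; last first.
    apply/measurable_EFinP.
    exact: (measurableT_comp (f := fun b : bool => b%:R : R)).
  rewrite EFinM; apply: lee_wpmul2l; first by rewrite lee_fin invr_ge0.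
  rewrite (eq_integral (fun w => (\1_[set w | F k w] w)%:E)); last first.
    move=> w _; rewrite indicE; congr ((nat_of_bool _)%:R)%:E.
    by apply/idP/idP; rewrite inE.
  by rewrite integral_indic// setIT; exact: flip_prob.
move=> H; have {H} := le_trans H (lee_sum _ (fun k _ => Fk k)).
rewrite sumEFin sumr_const card_ord -(mulr_natl (_ * a)) mulrA divff.
  2: by rewrite gt_eqF.
rewrite mul1r.
by rewrite EFinM muleC lee_pdivlMr.
Qed.

(** * Error of the matching estimator for fixed sizes *)

Lemma min_error_bound (u : 'I_n) (K k : nat) (delta2 t : R) :
  (\int[lebesgue_measure]_p (f p)%:E = 1)%E ->
  measurable_fun setT f -> (forall p, 0 <= f p <= delta2) ->
  (forall p, ~~ (0 < p < 1) -> f p = 0) ->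
  (k < K)%N -> 0 < t ->
  (min_error_prob S K u k <=
    (a + (K%:R * (t / 2) ^+ 2)^-1 + a / (t / 2) +
     n%:R * (2 * t * delta2))%:E)%E.
Proof.
move=> f_int mf f_le f_out kK t0.
have P01 v := param_range f_int v f_out.
have K0 : (0 < K)%N by apply: leq_trans kK.
have t20 : 0 < t / 2 by rewrite divr_gt0.
pose kk := Ordinal kK.
pose close (y : K.-tuple bool) (p : R) := `|avg R (tnth y) - p| <= t.
pose g (o : n.-tuple (K.-tuple bool) * n.-tuple R) :=
  [exists j, close (tnth o.1 j) (tnth o.2 u) && tnth (tnth o.1 j) kk].
have mg : measurable_fun setT g.
  have mY (j : 'I_n) : measurable_fun setT
      (fun o : n.-tuple (K.-tuple bool) * n.-tuple R => tnth o.1 j).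
    exact: (measurableT_comp (measurable_tnth j) measurable_fst).
  have mYk (j : 'I_n) (l : 'I_K) : measurable_fun setT
      (fun o : n.-tuple (K.-tuple bool) * n.-tuple R => tnth (tnth o.1 j) l).
    exact: (measurableT_comp (measurable_tnth l) (mY j)).
  apply: measurable_exists_fin => j; apply: measurable_and => //.
  apply: measurable_fun_ler => //; apply: measurableT_comp => //.
  apply: measurable_funB.
    exact: (measurable_avg (W := fun l o => tnth (tnth o.1 j) l)).
  exact: (measurableT_comp (measurable_tnth u) measurable_snd).
apply: (@le_trans _ _ (error_prob S g u k)).
  by apply: ereal_inf_lbound; exists g.
pose Z v w := [tuple obfuscated S v l w | l < K].
(* The permutation maps columns bijectively to users, so the existential over columns becomes one
   over users. *)
have gE w : g (observation S K w, params S w) =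
    [exists v, close (Z v w) (param S u w) && obfuscated S v k w].
  have obsE j : tnth (observation S K w) j = Z ((shuffle S w)^-1%g j) w.
    by rewrite tnth_mktuple.
  rewrite /g /= tnth_mktuple.
  apply/existsP/existsP => -[j]; rewrite ?obsE.
    by rewrite tnth_mktuple => H; exists ((shuffle S w)^-1%g j).
  by move=> H; exists (shuffle S w j); rewrite obsE permK tnth_mktuple.
have avgZ v w :
    avg R (tnth (Z v w)) = avg R (fun l : 'I_K => obfuscated S v l w).
  by rewrite /avg; under eq_bigr do rewrite tnth_mktuple.
(* The bad events, one for each term of the bound: the wanted bit is flipped, the data mean is off
   by more than [t / 2], at least a proportion [t / 2] of the bits is flipped, or some other user
   matches ([U] below). *)
pose F := [set w | obfuscated S u k w != data S u k w].
pose A1 := [set w |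
  t / 2 < `|avg R (fun l : 'I_K => data S u l w) - param S u w|].
pose A2 := [set w |
  t / 2 <= avg R (fun l : 'I_K => obfuscated S u l w != data S u l w)].
pose B v := [set w |
  `|avg R (fun l : 'I_K => obfuscated S v l w) - param S u w| <= t].
have mneq l : measurable_fun [set: Omega]
    (fun w => obfuscated S u l w != data S u l w).
  rewrite (_ : (fun w => _) = fun w => if data S u l w
    then ~~ obfuscated S u l w else obfuscated S u l w).
    by apply: measurable_fun_ifT => //; exact: measurable_neg.
  by apply/funext => w; case: (obfuscated _ _ _ _); case: (data _ _ _ _).
have mF : measurable F by exact: measurable_bool_event.
have mA1 : measurable A1.
  apply: measurable_bool_event; apply: measurable_fun_ltr => //.
  apply: measurableT_comp => //; apply: measurable_funB => //.
  by apply: measurable_avg => l.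
have mA2 : measurable A2.
  apply: measurable_bool_event; apply: measurable_fun_ler => //.
  by apply: measurable_avg => l.
have mcl v : measurable_fun [set: Omega] (fun w =>
    `|avg R (fun l : 'I_K => obfuscated S v l w) - param S u w| <= t).
  apply: measurable_fun_ler => //.
  apply: measurableT_comp => //; apply: measurable_funB => //.
  by apply: measurable_avg => l.
have mB v : measurable (B v) by exact: measurable_bool_event.
pose U := \bigcup_(v in [set` predC1 u]) B v.
have mU : measurable U by apply: fin_bigcup_measurable.
have sub : [set w | g (observation S K w, params S w) != data S u k w] `<=`
    F `|` A1 `|` A2 `|` U.
  move=> w /= gw; apply: contrapT.
  move=> /not_orP[/not_orP[/not_orP[/negP nF nA1] nA2] nU].
  move: nF; rewrite negbK => /eqP ZX.
  (* Off [A1] and [A2], the triangle inequality through the data mean spends [t / 2] on each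
     half. *)
  have cu : close (Z u w) (param S u w).
    rewrite /close avgZ.
    move: nA1 nA2; rewrite /A1 /A2 /= => /negP; rewrite -leNgt => nA1 /negP.
    rewrite -ltNge => nA2.
    have := abs_avg_sub_le R (fun l : 'I_K => data S u l w)
      (fun l : 'I_K => obfuscated S u l w).
    move=> H.
    apply: (le_trans (ler_distD (avg R (fun l : 'I_K => data S u l w)) _ _)).
    by rewrite [leRHS](splitr t) lerD// (le_trans H)// ltW.
  move: gw; rewrite gE => /negP; apply; apply/eqP.
  (* Off [U] only [u] can match, so the estimate is the obfuscated bit of [u], which off [F] is the
     data bit. *)
  rewrite -ZX; apply/existsP/idP.
    move=> [v /andP[cv Zv]]; case: (eqVneq v u) Zv => [->//|vu] _.
    by exfalso; apply: nU; exists v => //; rewrite /B /= -avgZ.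
  by move=> Zu; exists u; rewrite cu.
rewrite /error_prob; apply: (@le_trans _ _ (Pr (F `|` A1 `|` A2 `|` U))).
  apply: le_measure => //; rewrite inE.
    pose h w := [exists v, close (Z v w) (param S u w) && obfuscated S v k w].
    have mh : measurable_fun [set: Omega] h.
      apply: measurable_exists_fin => v; apply: measurable_and => //.
      rewrite (_ : (fun w => _) = fun w => `|avg R
        (fun l : 'I_K => obfuscated S v l w) - param S u w| <= t) => //.
      by apply/funext => w; rewrite /close avgZ.
    rewrite (_ : [set w | _] = [set w | if data S u k w then ~~ h w else h w]).
      apply: measurable_bool_event.
      by apply: measurable_fun_ifT => //; exact: measurable_neg.
    by apply/seteqP; split => w /=; rewrite gE -/(h w);
      case: (data _ _ _ _); case: (h w).
  by do 3 apply: measurableU => //.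
have mFA := measurableU _ _ mF mA1.
have mFAA := measurableU _ _ mFA mA2.
apply: le_trans; first exact: measureU2 mFAA mU.
rewrite EFinD; apply: leeD.
  apply: le_trans; first exact: measureU2 mFA mA2.
  rewrite EFinD; apply: leeD; last exact: flip_rate_prob.
  apply: le_trans; first exact: measureU2 mF mA1.
  rewrite EFinD; apply: leeD; first exact: flip_prob.
  exact: data_chebyshev.
have d20 : 0 <= 2 * t * delta2.
  by rewrite !mulr_ge0 ?(ltW t0)//; case/andP: (f_le 0); exact: le_trans.
apply: (@le_trans _ _ (\sum_(v \in [set` predC1 u]) Pr (B v))%E).
  exact: content_sub_fsum.
rewrite -(bigfs _ (index_enum_uniq _)); last first.
  by move=> v _; rewrite mem_index_enum.
apply: (@le_trans _ _ (\sum_(v | predC1 u v) (2 * t * delta2)%:E)%E).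
  by apply: lee_sum => v vu; apply: close_mean_prob; rewrite // eq_sym.
rewrite sumEFin lee_fin sumr_const -[leLHS]mulr_natl.
(* The number of other users is bounded by [n]. *)
by rewrite ler_wpM2r// ler_nat -[leqRHS]card_ord max_card.
Qed.

End noisy.

End model.

(** * Asymptotics and the choice of the window *)

Lemma powRN_nat_cvg0 (R : realType) (gamma : R) : 0 < gamma ->
  (n.+1%:R : R) `^ (- gamma) @[n --> \oo] --> 0.
Proof.
move=> g0; apply/cvgr0Pnorm_lt => e e0.
near=> n.
have M0 : 0 < (e^-1 `^ gamma^-1 : R) by rewrite powR_gt0// invr_gt0.
have Mn : e^-1 `^ gamma^-1 < n.+1%:R.
  apply: (@lt_le_trans _ _ n%:R); last by rewrite ler_nat.
  by near: n; exact: nbhs_infty_gtr.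
rewrite ger0_norm ?powR_ge0// powRN invf_plt ?posrE ?powR_gt0//.
have := @gt0_ltr_powR _ gamma g0 _ _ (ltW M0) (ler0n _ _) Mn.
by rewrite -powRrM mulVf ?gt_eqF// powRr1// invr_ge0 ltW.
Unshelve. all: by end_near. Qed.

(** Continuity is assumed on the open interval only, with possible jumps at 0 and 1; [f] is the
    extension by zero of its restriction there. *)
Lemma density_measurable (R : realType) (f : R -> R) :
  {in `]0, 1[, continuous f} -> (forall p, ~~ (0 < p < 1) -> f p = 0) ->
  measurable_fun setT f.
Proof.
move=> f_cont f_out.
have -> : f = f \_ `]0, 1[.
  apply/funext => p; rewrite patchE; case: ifPn => //.
  by rewrite notin_setE /= in_itv /= => /negP/f_out.
apply/(measurable_restrictT _ _).1 => //.
apply: open_continuous_measurable_fun; first exact: interval_open.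
by move=> p /[!inE] pI; apply: f_cont.
Qed.

(* The window [t = s^-(1+gamma)] with [2 gamma <= beta] and [4 gamma <= alpha]
   makes every term of [min_error_bound] a constant times [s^-gamma]. *)
Lemma error_rate (R : realType) (c alpha c' beta gamma delta2 s m a t : R) :
  0 < c -> 0 < c' -> 0 < gamma -> 2 * gamma <= beta -> 4 * gamma <= alpha ->
  0 <= delta2 -> 1 <= s -> 2 / c <= s -> 0 < m ->
  `|m - c * s `^ (2 + alpha)| < 1 ->
  a = c' * s `^ (- (1 + beta)) -> t = s `^ (- (1 + gamma)) ->
  a + (m * (t / 2) ^+ 2)^-1 + a / (t / 2) + s * (2 * t * delta2) <=
  (3 * c' + 8 / c + 2 * delta2) * s `^ (- gamma).
Proof.
move=> c0 c'0 g0 gb ga d20 s1 sc m0 hm aE tE.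
have s0 : 0 < s by apply: lt_le_trans s1.
have sD x y : s `^ (x + y) = s `^ x * s `^ y.
  by rewrite powRD//; apply/implyP => _; rewrite gt_eqF.
have t0 : 0 < t by rewrite tE powR_gt0.
have mono x y : x <= y -> s `^ x <= s `^ y by exact: ler_powR.
have H1 : a <= c' * s `^ (- gamma).
  by rewrite aE; apply: ler_wpM2l; [exact: ltW|apply: mono; lra].
(* The exponent is [gamma - beta], at most [- gamma] because [2 * gamma <= beta]. *)
have H3 : a / (t / 2) <= 2 * c' * s `^ (- gamma).
  rewrite ler_pdivrMr ?divr_gt0// aE tE.
  rewrite (_ : 2 * c' * s `^ (- gamma) * (s `^ (- (1 + gamma)) / 2) =
               c' * (s `^ (- gamma) * s `^ (- (1 + gamma)))); last by field.
  rewrite -sD; apply: ler_wpM2l; first exact: ltW.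
  by apply: mono; lra.
have H4 : s * (2 * t * delta2) = 2 * delta2 * s `^ (- gamma).
  rewrite tE (_ : - (1 + gamma) = - 1 + - gamma); last by ring.
  rewrite sD powR_inv1 ?(ltW s0)//.
  by field; rewrite gt_eqF.
have H2 : (m * (t / 2) ^+ 2)^-1 <= 8 / c * s `^ (- gamma).
  have mc : c / 2 * s `^ (2 + alpha) <= m.
    have : s <= s `^ (2 + alpha) by apply: le1r_powR => //; lra.
    move=> /(le_trans sc); rewrite ler_pdivrMr// => h.
    by move: hm; rewrite ltr_norml => /andP[h1 _]; lra.
  have -> : 8 / c * s `^ (- gamma) = (c / 8 * s `^ gamma)^-1.
    by rewrite powRN; field; rewrite !gt_eqF// powR_gt0.
  have u0 : 0 < c / 8 * s `^ gamma by rewrite mulr_gt0 ?divr_gt0 ?powR_gt0.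
  rewrite lef_pV2 ?posrE ?mulr_gt0 ?exprn_gt0 ?divr_gt0 ?powR_gt0//.
  apply: (@le_trans _ _ (c / 2 * s `^ (2 + alpha) * (t / 2) ^+ 2)); last first.
    by apply: ler_wpM2r => //; exact: sqr_ge0.
  rewrite (_ : c / 2 * s `^ (2 + alpha) * (t / 2) ^+ 2 =
    c / 8 * (s `^ (2 + alpha) * t * t)); last by field.
  apply: ler_wpM2l; first by rewrite ltW ?divr_gt0.
  (* The exponent [2 + alpha - 2 * (1 + gamma)] is [alpha - 2 * gamma], at least [gamma] because
     [4 * gamma <= alpha]. *)
  by rewrite tE -!sD; apply: mono; lra.
rewrite H4; lra.
Qed.

Theorem theorem3 (R : realType)
  (f : R -> R) (delta1 delta2 : R)
  (hdelta1 : 0 < delta1) (hdelta2 : 0 < delta2)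
  (hf_cont : {in `]0, 1[, continuous f})
  (hf_bounds : forall p : R, 0 < p < 1 -> delta1 < f p < delta2)
  (hf_out : forall p : R, ~~ (0 < p < 1) -> f p = 0)
  (hf_int : (\int[lebesgue_measure]_p (f p)%:E = 1)%E)
  (c alpha c' beta : R)
  (hc : 0 < c) (halpha : 0 < alpha) (hc' : 0 < c') (hbeta : alpha / 4 < beta)
  (m : nat -> nat) (a : nat -> R)
  (hm : forall n : nat, (0 < n)%N ->
    `|(m n)%:R - c * n%:R `^ (2 + alpha)| < 1)
  (ha : forall n : nat, (0 < n)%N -> a n = c' * n%:R `^ (- (1 + beta)))
  (d : nat -> measure_display) (Omega : forall n : nat, measurableType (d n))
  (Pr : forall n : nat, probability (Omega n) R)
  (S : forall n : nat, users (Pr n) n.+1)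
  (hS : forall n : nat, a n.+1 <= 1 -> two_states_model (S n) f (a n.+1)) :
  forall k : nat,
    min_error_prob (S n) (m n.+1) ord0 k @[n --> \oo] --> 0%E.
Proof.
move=> k.
(* Largest exponent with [2 * gamma <= beta] and [4 * gamma <= alpha], the two constraints of
   [error_rate]. *)
pose gamma := Num.min beta (alpha / 2) / 2.
have beta0 : 0 < beta by apply: lt_trans hbeta; rewrite divr_gt0.
have g0 : 0 < gamma by rewrite divr_gt0// lt_min beta0 divr_gt0.
have gb : 2 * gamma <= beta.
  by rewrite mulrC divfK// ge_min lexx.
have ga : 4 * gamma <= alpha.
  have : Num.min beta (alpha / 2) <= alpha / 2 by rewrite ge_min lexx orbT.
  by rewrite /gamma; lra.
have mf := density_measurable hf_cont hf_out.
have f_le p : 0 <= f p <= delta2.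
  case: (boolP (0 < p < 1)) => [/hf_bounds/andP[h1 h2]|/hf_out ->].
    by rewrite !ltW// (lt_trans hdelta1).
  by rewrite lexx ltW.
pose C := 3 * c' + 8 / c + 2 * delta2.
pose h n : R := C * n.+1%:R `^ (- gamma).
have h_cvg : h n @[n --> \oo] --> 0.
  rewrite -(mulr0 C); apply: cvgM; [exact: cvg_cst|exact: powRN_nat_cvg0].
apply: (@squeeze_cvge _ _ _ _ (fun=> 0%E) _ (fun n => (h n)%:E)); last first.
- by apply: cvg_EFin => //; exact: nearW.
- exact: cvg_cst.
near=> n; apply/andP; split.
  by apply/ereal_infP => _ [g _ <-]; exact: measure_ge0.
set s : R := n.+1%:R.
have s1 : 1 <= s by rewrite ler1n.
have large (M : R) : M < n%:R -> M <= s.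
  by move=> Mn; apply: (le_trans (ltW Mn)); rewrite ler_nat.
have sc : 2 / c <= s by apply: large; near: n; exact: nbhs_infty_gtr.
have mk : (k < m n.+1)%N.
  have sk : (k%:R + 1) / c <= s by apply: large; near: n; exact: nbhs_infty_gtr.
  have : s <= s `^ (2 + alpha) by apply: le1r_powR => //; lra.
  move=> /(le_trans sk); rewrite ler_pdivrMr// => h1.
  have := hm n.+1 (ltn0Sn n); rewrite ltr_norml -/s => /andP[h2 _].
  by rewrite -(ltr_nat R); lra.
have a0 : 0 <= a n.+1 by rewrite ha// mulr_ge0 ?powR_ge0// ltW.
have a1 : a n.+1 <= 1.
  have sc' : c' <= s by apply: large; near: n; exact: nbhs_infty_gtr.
  rewrite ha// -/s powRN ler_pdivrMr ?mul1r ?powR_gt0 ?(lt_le_trans ltr01)//.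
  by apply: (le_trans sc'); apply: le1r_powR => //; lra.
have t0 : 0 < s `^ (- (1 + gamma)) by rewrite powR_gt0// (lt_le_trans ltr01).
have := min_error_bound (hS n a1) a0 a1 ord0 hf_int mf f_le hf_out mk t0.
move=> /le_trans; apply.
rewrite lee_fin ha//; apply: (error_rate (alpha := alpha) (beta := beta)) => //.
- exact: ltW.
- by rewrite ltr0n; apply: leq_trans mk.
- exact: hm.
Unshelve. all: by end_near. Qed.
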